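(* Let $X$ be a set of $m \ge 1$ Boolean variables and let $\phi$ be a CNF formula over $X$ with $\mathrm{vars}(\phi) = X$. Assume that $\mathrm{ClusterVarOrder}(\phi)$ returns an injection $\rho : X \to \mathbb{N}$, and that all calls to $\mathrm{ClauseRank}$ and $\mathrm{ChosenCluster}$ made by the cluster algorithm (described in the context) satisfy: 1. $1 \le \mathrm{ClauseRank}(c, \rho) \le m$; 2. $i < \mathrm{ChosenCluster}(n_i) \le m$; and 3. $X_s \cap \mathrm{vars}(n_i) = \emptyset$ for all integers $s$ with $i < s < \mathrm{ChosenCluster}(n_i)$. Then the cluster algorithm, on input $X$ and $\phi$, returns a project-join tree of $\phi$.
   Context: A CNF formula $\phi$ over $X$ is a finite set of clauses; $\mathrm{vars}(c)$ is the set of variables appearing in clause $c$, and $\mathrm{vars}(\Gamma) = \bigcup_{c \in \Gamma} \mathrm{vars}(c)$ for a set $\Gamma$ of clauses. A project-join tree of $\phi$ is a tuple $(T, r, \gamma, \pi)$ where $T$ is a finite tree with root $r$, $\mathcal{L}(T)$ is its set of leaves (nodes with no children), $\gamma : \mathcal{L}(T) \to \phi$ is a bijection, and $\pi : \mathcal{V}(T) \setminus \mathcal{L}(T) \to 2^X$ labels internal nodes, such that: (1) the sets $\pi(n)$, $n$ ranging over internal nodes, form a partition of $X$ (pairwise disjoint for distinct nodes, with union $X$; some may be empty); (2) for each internal node $n$, each $x \in \pi(n)$, and each clause $c \in \phi$ in which $x$ appears, the leaf $\gamma^{-1}(c)$ is a descendant of $n$. For a node $n$ with set of children $\mathcal{C}(n)$: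 $\mathrm{vars}(n) = \mathrm{vars}(\gamma(n))$ if $n$ is a leaf, and $\mathrm{vars}(n) = \left(\bigcup_{o \in \mathcal{C}(n)} \mathrm{vars}(o)\right) \setminus \pi(n)$ if $n$ is internal. Cluster algorithm (input $X$ with $|X| = m \ge 1$, and $\phi$; parametrized by functions $\mathrm{ClusterVarOrder}$, $\mathrm{ClauseRank}$, $\mathrm{ChosenCluster}$): - Start with an empty tree. Let $\rho = \mathrm{ClusterVarOrder}(\phi)$. - For $i = m, m-1, \ldots, 1$: let $\Gamma_i = \{c \in \phi : \mathrm{ClauseRank}(c, \rho) = i\}$; let $\kappa_i$ be the set consisting of one newly created leaf $l$ with $\gamma(l) = c$ for each $c \in \Gamma_i$; let $X_i = \mathrm{vars}(\Gamma_i) \setminus \bigcup_{j=i+1}^m \mathrm{vars}(\Gamma_j)$. - For $i = 1, 2, \ldots, m$: if $\kappa_i \neq \emptyset$, create a new internal node $n_i$ with children $\mathcal{C}(n_i) = \kappa_i$ and label $\pi(n_i) = X_i$; then, if $i < m$, let $j = \mathrm{ChosenCluster}(n_i)$ and replace $\kappa_j$ by $\kappa_j \cup \{n_i\}$. - Return $(T, n_m, \gamma, \pi)$. *)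

(* Defs.v *)
From mathcomp Require Import all_boot finmap.

Set Implicit Arguments.
Unset Strict Implicit.
Unset Printing Implicit Defensive.

Local Open Scope fset_scope.
Local Open Scope fmap_scope.

(* The literal [(x, true)] is x and [(x, false)] is its negation.  The set X
   of variables is a finite type.  The empty formula, the empty clause and
   tautological clauses are allowed. *)
Definition clause (X : finType) := {set X * bool}.
Definition cnf (X : finType) := {set clause X}.

Definition clause_vars (X : finType) (c : clause X) : {set X} :=
  [set l.1 | l in c].

Definition vars (X : finType) (G : {set clause X}) : {set X} :=
  \bigcup_(c in G) clause_vars c.

Definition node := nat.

(* A finite directed graph: the domain of the map is the node set, and the map
   sends each node to its set of children. *)
Definition digraph := {fmap node -> {fset node}}.

Definition nodes (T : digraph) : {fset node} := domf T.

Definition children (T : digraph) (n : node) : {fset node} :=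
  odflt fset0 T.[? n].

Definition child (T : digraph) : rel node := fun n o => o \in children T n.

Definition leaves (T : digraph) : {fset node} :=
  [fset n in nodes T | children T n == fset0].

Definition internal_nodes (T : digraph) : {fset node} :=
  nodes T `\` leaves T.

(* Rooted trees are arborescences: there is exactly one directed walk from the
   root to each node (in particular only the empty one to the root itself). *)
Definition rooted_tree (T : digraph) (r : node) : Prop :=
  [/\ r \in nodes T,
      forall n, children T n `<=` nodes T
    & forall n, n \in nodes T ->
        exists! p : seq node, path (child T) r p /\ last r p = n].

Definition descendant (T : digraph) (n o : node) : Prop :=
  exists p : seq node, path (child T) n p /\ last n p = o.

Record labeled_tree (X : finType) := LabeledTree {
  lt_tree : digraph;
  lt_root : node;
  lt_gamma : {fmap node -> clause X};
  lt_pi : {fmap node -> {set X}}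
}.

Definition gamma_bijection (X : finType) (phi : cnf X) (T : digraph)
    (gamma : {fmap node -> clause X}) : Prop :=
  [/\ domf gamma = leaves T,
      forall (l : node) c, gamma.[? l] = Some c -> c \in phi
    & forall c, c \in phi -> exists! l : node, gamma.[? l] = Some c].

(* Blocks may be empty, unlike in [finset.partition]. *)
Definition pi_partition (X : finType) (T : digraph)
    (pi : {fmap node -> {set X}}) : Prop :=
  [/\ domf pi = internal_nodes T,
      forall (n1 n2 : node) A1 A2, pi.[? n1] = Some A1 -> pi.[? n2] = Some A2 ->
        n1 <> n2 -> A1 :&: A2 = set0
    & forall x : X, exists (n : node) A, pi.[? n] = Some A /\ x \in A].

Definition project_join_tree (X : finType) (phi : cnf X)
    (t : labeled_tree X) : Prop :=
  let: LabeledTree T r gamma pi := t in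
  [/\ rooted_tree T r,
      gamma_bijection phi T gamma,
      pi_partition T pi
    & forall (n : node) A x c (l : node), pi.[? n] = Some A -> x \in A ->
        c \in phi -> x \in clause_vars c -> gamma.[? l] = Some c ->
        descendant T n l].

(* [node_var T gamma pi n x] says that x belongs to vars(n).  The recursive
   equations for vars(n) are read as an inductive definition, which makes sense
   without first knowing that T is a tree: during the run of the algorithm the
   graph is only a forest. *)
Inductive node_var (X : finType) (T : digraph)
    (gamma : {fmap node -> clause X}) (pi : {fmap node -> {set X}}) :
    node -> X -> Prop :=
| NodeVarLeaf n c x : n \in leaves T -> gamma.[? n] = Some c ->
    x \in clause_vars c -> node_var T gamma pi n x
| NodeVarInternal n A o x : n \in internal_nodes T -> pi.[? n] = Some A ->
    o \in children T n -> node_var T gamma pi o x -> x \notin A ->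
    node_var T gamma pi n x.

(* The store of the cluster algorithm.  [st_n] holds the program variables
   n_i, which are only assigned for the i with kappa_i nonempty; [st_next] is
   the name of the next node to be created. *)
Record cluster_state (X : finType) := ClusterState {
  st_tree : digraph;
  st_gamma : {fmap node -> clause X};
  st_pi : {fmap node -> {set X}};
  st_kappa : nat -> {fset node};
  st_n : {fmap nat -> node};
  st_next : node
}.

Definition state_var (X : finType) (s : cluster_state X) : node -> X -> Prop :=
  node_var (st_tree s) (st_gamma s) (st_pi s).

Definition empty_state (X : finType) : cluster_state X :=
  ClusterState [fmap] [fmap] [fmap] (fun=> fset0) [fmap] 0.

Definition Gamma (X : finType) (phi : cnf X)
    (ClauseRank : clause X -> (X -> nat) -> nat) (rho : X -> nat) (i : nat) :
    {set clause X} :=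
  [set c in phi | ClauseRank c rho == i].

Definition cluster_vars (X : finType) (phi : cnf X)
    (ClauseRank : clause X -> (X -> nat) -> nat) (rho : X -> nat) (i : nat) :
    {set X} :=
  vars (Gamma phi ClauseRank rho i)
    :\: \bigcup_(i.+1 <= j < #|X|.+1) vars (Gamma phi ClauseRank rho j).

Definition new_leaf (X : finType) (i : nat) (s : cluster_state X)
    (c : clause X) : cluster_state X :=
  let l := st_next s in
  ClusterState (st_tree s).[l <- fset0] (st_gamma s).[l <- c] (st_pi s)
    [eta st_kappa s with i |-> l |` st_kappa s i] (st_n s) l.+1.

Definition init_clusters (X : finType) (phi : cnf X)
    (ClauseRank : clause X -> (X -> nat) -> nat) (rho : X -> nat) :
    cluster_state X :=
  foldl (fun s i => foldl (new_leaf i) s (enum (Gamma phi ClauseRank rho i)))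
    (empty_state X) (rev (iota 1 #|X|)).

(* Creates the node n_i, with set of children kappa_i and label Xi. *)
Definition new_internal (X : finType) (i : nat) (Xi : {set X})
    (s : cluster_state X) : cluster_state X :=
  let n := st_next s in
  ClusterState (st_tree s).[n <- st_kappa s i] (st_gamma s)
    (st_pi s).[n <- Xi] (st_kappa s) (st_n s).[i <- n] n.+1.

Definition add_to_cluster (X : finType) (j : nat) (n : node)
    (s : cluster_state X) : cluster_state X :=
  ClusterState (st_tree s) (st_gamma s) (st_pi s)
    [eta st_kappa s with j |-> st_kappa s j `|` [fset n]] (st_n s) (st_next s).

(* ChosenCluster also takes the current state, since the name of n_i alone does
   not give access to the subtree below it. *)
Definition cluster_step (X : finType) (phi : cnf X)
    (ClauseRank : clause X -> (X -> nat) -> nat) (rho : X -> nat)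
    (ChosenCluster : cluster_state X -> node -> nat)
    (s : cluster_state X) (i : nat) : cluster_state X :=
  if st_kappa s i == fset0 then s
  else
    let n := st_next s in
    let s' := new_internal i (cluster_vars phi ClauseRank rho i) s in
    if i < #|X| then add_to_cluster (ChosenCluster s' n) n s' else s'.

(* The state after iterations 1, ..., k of the second loop. *)
Definition cluster_loop (X : finType) (phi : cnf X)
    (ClauseRank : clause X -> (X -> nat) -> nat) (rho : X -> nat)
    (ChosenCluster : cluster_state X -> node -> nat) (k : nat) :
    cluster_state X :=
  foldl (cluster_step phi ClauseRank rho ChosenCluster)
    (init_clusters phi ClauseRank rho) (iota 1 k).

(* The result is [None] if n_m was never created. *)
Definition cluster (X : finType) (phi : cnf X)
    (ClusterVarOrder : cnf X -> X -> nat)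
    (ClauseRank : clause X -> (X -> nat) -> nat)
    (ChosenCluster : cluster_state X -> node -> nat) :
    option (labeled_tree X) :=
  let s := cluster_loop phi ClauseRank (ClusterVarOrder phi) ChosenCluster #|X|
  in omap (fun n => LabeledTree (st_tree s) n (st_gamma s) (st_pi s))
       (st_n s).[? #|X|].

(* Iteration i of the second loop calls ChosenCluster on n_i = n, and s is the
   state at the time of the call. *)
Definition chosen_cluster_call (X : finType) (phi : cnf X)
    (ClauseRank : clause X -> (X -> nat) -> nat) (rho : X -> nat)
    (ChosenCluster : cluster_state X -> node -> nat)
    (i : nat) (s : cluster_state X) (n : node) : Prop :=
  let s0 := cluster_loop phi ClauseRank rho ChosenCluster i.-1 in
  [/\ 1 <= i < #|X|,
      st_kappa s0 i <> fset0,
      s = new_internal i (cluster_vars phi ClauseRank rho i) s0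
    & n = st_next s0].

(* Main.v *)
Require Import Defs.
From mathcomp Require Import all_boot finmap.

(** A node has a smaller name than its parent, the nodes other than n_m each lie
    in exactly one kappa_i, and n_i is the only node whose set of children is
    kappa_i; hence the final graph is a tree rooted at n_m.  The sets X_i
    partition X because x belongs to X_i exactly when i is the largest rank of
    a clause containing x.  For the descendant condition, follow the ancestors
    of the leaf of a clause c containing x in X_i: it starts in kappa_j with
    j <= i, and as long as j < i the node n_j keeps x among its variables, so
    that hypothesis 3 forbids ChosenCluster(n_j) from jumping over i. *)

(** * Directed graphs, their extensions, and a criterion for rooted trees *)

Section Digraphs.

Set Implicit Arguments.
Unset Strict Implicit.

Local Open Scope fmap_scope.

Lemma in_domf (K : choiceType) (V : Type) (f : {fmap K -> V}) (k : K) :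
  (k \in domf f) = isSome f.[? k].
Proof. by case: fndP => // kf; apply/negbTE. Qed.

Lemma in_leaves (T : digraph) (n : node) :
  (n \in leaves T) = (n \in nodes T) && (children T n == fset0).
Proof. by rewrite !inE. Qed.

Lemma in_internal_nodes (T : digraph) (n : node) :
  (n \in internal_nodes T) = (n \in nodes T) && (children T n != fset0).
Proof. by rewrite inE in_leaves; case: (n \in nodes T); rewrite ?andbT ?andbF. Qed.

Lemma children_nodes (T : digraph) (n o : node) :
  o \in children T n -> n \in nodes T.
Proof. by rewrite /nodes (in_domf T) /children; case: fndP. Qed.

Lemma descendant_trans (T : digraph) (n o l : node) :
  descendant T n o -> descendant T o l -> descendant T n l.
Proof.
move=> [p [np <-]] [q [oq <-]]; exists (p ++ q).
by rewrite cat_path np oq last_cat.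
Qed.

Lemma descendant_child (T : digraph) (n o l : node) :
  o \in children T n -> descendant T o l -> descendant T n l.
Proof.
move=> no; apply: descendant_trans; exists [:: o].
by rewrite /= /child no.
Qed.

(** Nodes may be added, but the child sets of old nodes stay fixed. This is how an iteration of the
    second loop changes the graph, so what lies below an old node is preserved. *)
Definition extends (T T' : digraph) : Prop :=
  {in nodes T, forall n, T'.[? n] = T.[? n]}.

Lemma extends_nodes {T T' : digraph} {n : node} :
  extends T T' -> n \in nodes T -> n \in nodes T'.
Proof. by move=> TT' nT; rewrite /nodes (in_domf T') TT' // -in_domf. Qed.

Lemma extends_children {T T' : digraph} {n : node} :
  extends T T' -> n \in nodes T -> children T' n = children T n.
Proof. by move=> TT' nT; rewrite /children TT'. Qed.

Lemma extends_descendant {T T' : digraph} {n l : node} :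
  extends T T' -> descendant T n l -> descendant T' n l.
Proof.
move=> TT' [p [np <-]]; exists p; split=> //; apply: sub_path np => a b ab.
by rewrite /child (extends_children TT') // (children_nodes ab).
Qed.

Lemma extends_node_var (X : finType) (T T' : digraph)
    (gamma gamma' : {fmap node -> clause X}) (pi pi' : {fmap node -> {set X}})
    (n : node) (x : X) :
    extends T T' ->
    (forall l c, gamma.[? l] = Some c -> gamma'.[? l] = Some c) ->
    (forall v A, pi.[? v] = Some A -> pi'.[? v] = Some A) ->
  node_var T gamma pi n x -> node_var T' gamma' pi' n x.
Proof.
move=> TT' gg' pp'; elim=> {n x} [n c x | n A o x].
  rewrite in_leaves => /andP[nT n0] nc cx.
  apply: NodeVarLeaf (gg' _ _ nc) cx.
  by rewrite in_leaves (extends_nodes TT') // (extends_children TT').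
rewrite in_internal_nodes => /andP[nT n0] nA no _ ox xA.
apply: NodeVarInternal (pp' _ _ nA) _ ox xA.
  by rewrite in_internal_nodes (extends_nodes TT') // (extends_children TT').
by rewrite (extends_children TT').
Qed.

(** Names strictly increase from child to parent and [r] is the largest, so climbing through unique
    parents ends at [r]. The walk from [r] to [n] is the walk to the parent of [n], followed by
    [n]. *)
Lemma rooted_tree_of_parents (T : digraph) (r : node) :
    r \in nodes T ->
    {in nodes T, forall n, n <= r} ->
    (forall n o, o \in children T n -> o \in nodes T /\ o < n) ->
    {in nodes T, forall o, o != r -> exists n, o \in children T n} ->
    (forall n n' o, o \in children T n -> o \in children T n' -> n = n') ->
  rooted_tree T r.
Proof.
move=> rT ler childP parent_ex parent_uniq.
split=> // [n | n nT]; first by apply/fsubsetP => o /childP[].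
(* Induction on [r - n], which is smaller for the parent of [n]. *)
have [k] := ubnP (r - n); elim: k n nT => // k IHk n nT /ltnSE-le_k.
have root_orphan a : ~~ child T a r.
  apply/negP=> ar; have [_] := childP _ _ ar.
  by rewrite ltnNge ler // (children_nodes ar).
have [-> | n_r] := eqVneq n r.
  exists [::]; split=> // p [rp lp]; case/lastP: p => // p z in rp lp *.
  rewrite last_rcons in lp; move: rp; rewrite rcons_path lp.
  by rewrite (negbTE (root_orphan _)) andbF.
have [a an] := parent_ex n nT n_r.
have aT := children_nodes an; have [_ lt_na] := childP _ _ an.
have [|p [[rp lp] uniq_p]] := IHk a aT.
  by apply: leq_trans le_k; apply: ltn_sub2l => //; apply: leq_trans (ler _ aT).
exists (rcons p n); split; first by rewrite rcons_path rp lp /child an last_rcons.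
(* A walk to [n] is nonempty since [n] is not [r]; its last edge starts at the only parent [a], so
   the rest is the unique walk to [a]. *)
move=> q [rq lq]; case/lastP: q => [|q z] in rq lq *.
  by rewrite -lq eqxx in n_r.
move: rq lq; rewrite rcons_path last_rcons => /andP[rq qz] zn; rewrite {}zn in qz *.
by rewrite (uniq_p q) //; split=> //; apply: parent_uniq qz an.
Qed.

End Digraphs.

Section Cluster.

Set Implicit Arguments.
Unset Strict Implicit.

Local Open Scope fmap_scope.

Variables (X : finType) (phi : cnf X).
Variables (ClauseRank : clause X -> (X -> nat) -> nat) (rho : X -> nat).
Variable ChosenCluster : cluster_state X -> node -> nat.

Let m := #|X|.
Let rank (c : clause X) := ClauseRank c rho.
Let Xs := cluster_vars phi ClauseRank rho.
Let loop := cluster_loop phi ClauseRank rho ChosenCluster.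


(** * The sets X_i in terms of clause ranks *)

Lemma in_bigcup_seq (I : eqType) (r : seq I) (F : I -> {set X}) (x : X) :
  (x \in \bigcup_(i <- r) F i) = has (fun i => x \in F i) r.
Proof.
by elim: r => [|i r IHr]; rewrite ?big_nil ?big_cons inE //= IHr.
Qed.

Lemma varsP (G : {set clause X}) (x : X) :
  reflect (exists2 c, c \in G & x \in clause_vars c) (x \in vars G).
Proof. exact: bigcupP. Qed.

(** The index [i] is the largest rank of a clause containing [x]. The guard [rank c <= m] mirrors
    the union in [cluster_vars], which stops at [m]. *)
Lemma cluster_varsP (i : nat) (x : X) :
  reflect ((exists c, [/\ c \in phi, rank c = i & x \in clause_vars c]) /\
           (forall c, c \in phi -> x \in clause_vars c -> rank c <= m ->
              rank c <= i))
          (x \in Xs i).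
Proof.
rewrite in_setD in_bigcup_seq; apply: (iffP andP) => -[].
  move=> xNj /varsP[c]; rewrite inE => /andP[cphi /eqP rc] xc.
  split=> [|d dphi xd rd]; first by exists c.
  rewrite leqNgt; apply: contra xNj => lt_i; apply/hasP; exists (rank d).
    by rewrite mem_index_iota lt_i.
  by apply/varsP; exists d; rewrite // inE dphi /=.
move=> [c [cphi rc xc]] maxi; split; last first.
  by apply/varsP; exists c; rewrite // inE cphi -rc /=.
apply/hasPn => j; rewrite mem_index_iota => /andP[lt_ij lt_jm].
apply/varsP=> -[d]; rewrite inE => /andP[dphi /eqP rd] xd.
by move: (maxi d dphi xd); rewrite /rank rd -ltnS lt_jm leqNgt lt_ij => /(_ isT).
Qed.

(** * The first loop: leaves and initial clusters *)

(** Invariant of the first loop, where [L] lists the clauses that already have a leaf. The graph and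
    the clusters are both read off from [st_gamma]: all nodes are isolated, and the rank of its
    clause decides the cluster of a leaf. *)
Definition initial (L : seq (clause X)) (s : cluster_state X) : Prop :=
  [/\ st_pi s = [fmap] /\ st_n s = [fmap],
      forall v, (st_tree s).[? v] = omap (fun=> fset0) (st_gamma s).[? v],
      forall i v, (v \in st_kappa s i) = (omap rank (st_gamma s).[? v] == Some i),
      forall v c, (st_gamma s).[? v] = Some c -> v < st_next s /\ c \in L
    & forall c, c \in L -> exists! v, (st_gamma s).[? v] = Some c].

Lemma initial_new_leaf (L : seq (clause X)) (s : cluster_state X) (c : clause X) :
  c \notin L -> initial L s -> initial (rcons L c) (new_leaf (rank c) s c).
Proof.
move=> cL [pin treeE kappaE gammaL gamma_uniq].
have next_fresh: (st_gamma s).[? st_next s] = None.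
  by case gE: _.[? _] => // [d]; have [] := gammaL _ _ gE; rewrite ltnn.
split=> // [v | i v | v d | d] /=.
- by rewrite !fnd_set treeE; case: eqP.
- rewrite fnd_set /=; have [->|vn] := eqVneq v (st_next s).
    rewrite -[Some _ == _]/(rank c == i) [rank c == i]eq_sym; case: eqP => _; first by rewrite fset1U1.
    by rewrite kappaE next_fresh.
  by case: eqP => [->|_]; rewrite ?in_fset1U ?(negbTE vn) kappaE.
- rewrite fnd_set mem_rcons inE; case: eqP => [-> [<-]|_ /gammaL[vn dL]].
    by rewrite eqxx ltnS.
  by rewrite dL orbT ltnS (ltnW vn).
(* For [c] itself the new leaf is the only one, because an older leaf labeled [c] would put [c] in
   [L]. *)
rewrite mem_rcons inE; case: (eqVneq d c) => [-> _ | dc /= dL].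
  exists (st_next s); split; first by rewrite fnd_set eqxx.
  move=> v; rewrite fnd_set; case: eqP => // _ /gammaL[_].
  by rewrite (negbTE cL).
have [v [gv uv]] := gamma_uniq d dL; exists v.
have [vn _] := gammaL _ _ gv.
split=> [|w]; rewrite fnd_set; first by rewrite ltn_eqF.
by case: eqP => [_ [cd]|_ /uv //]; rewrite cd eqxx in dc.
Qed.

Lemma initial_foldl (L L' : seq (clause X)) (s : cluster_state X) (i : nat) :
    uniq (L ++ L') -> {in L', forall c, rank c = i} ->
  initial L s -> initial (L ++ L') (foldl (new_leaf i) s L').
Proof.
elim: L' L s => [|c L' IHL'] L s; first by rewrite cats0.
rewrite -cat_rcons => uL iL' Ls /=; apply: IHL' => // [d dL'|].
  by apply: iL'; rewrite inE dL' orbT.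
rewrite -(iL' c) ?mem_head //; apply: initial_new_leaf => //.
by move: uL; rewrite cat_uniq rcons_uniq => /andP[/andP[]].
Qed.

Hypothesis rank_bounds : {in phi, forall c, 1 <= rank c <= m}.

Lemma initial_init_clusters :
  exists2 L, L =i phi & initial L (init_clusters phi ClauseRank rho).
Proof.
pose G := Gamma phi ClauseRank rho.
have inG i c : (c \in G i) = (c \in phi) && (rank c == i) by rewrite inE.
pose init r := foldl (fun s i => foldl (new_leaf i) s (enum (G i))) (empty_state X) r.
(* Generalized to any duplicate-free list [r] of ranks, so that induction can follow the order of
   the loop. *)
have initP r : uniq r -> exists L, [/\ uniq L,
    forall c, (c \in L) = (c \in phi) && (rank c \in r) & initial L (init r)].
  elim/last_ind: r => [_ | r i IHr].
    exists [::]; split=> // [c|]; first by rewrite andbF.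
    by split=> // [v | i v | v c]; rewrite ?fnd_fmap0 ?inE.
  rewrite rcons_uniq => /andP[ir /IHr[L [uL LE Ls]]].
  (* Clauses in [L] have their rank in [r], which does not contain [i]. *)
  have uLG : uniq (L ++ enum (G i)).
    rewrite cat_uniq uL enum_uniq andbT /=; apply/hasPn => c.
    rewrite mem_enum inG LE => /andP[-> /eqP->] //.
  exists (L ++ enum (G i)); split=> // [c|].
    by rewrite mem_cat LE mem_enum inG mem_rcons inE -andb_orr orbC.
  rewrite /init -cats1 foldl_cat /=; apply: initial_foldl => // c.
  by rewrite mem_enum inG => /andP[_ /eqP].
have [|L [_ LE Ls]] := initP (rev (iota 1 m)); first by rewrite rev_uniq iota_uniq.
exists L => // c; rewrite LE mem_rev mem_iota add1n ltnS.
by case cphi: (c \in phi) => //=; apply: rank_bounds.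
Qed.


(** * Invariants of the second loop *)

(** Holds after [k] iterations. A cluster kappa_i is not emptied when n_i is created, so for i <=
    [k] it still records the children of n_i. Membership in a cluster thus encodes the parent of a
    node, present or future. *)
Record forest (k : nat) (s : cluster_state X) : Prop := Forest {
  forest_lt_next : {in nodes (st_tree s), forall v, v < st_next s};
  forest_children : forall v o, o \in children (st_tree s) v ->
    o \in nodes (st_tree s) /\ o < v;
  forest_kappa : forall i v, v \in st_kappa s i ->
    v \in nodes (st_tree s) /\ 0 < i <= m;
  forest_kappa_inj : forall i j v,
    v \in st_kappa s i -> v \in st_kappa s j -> i = j;
  forest_n : forall i v, (st_n s).[? i] = Some v ->
    [/\ 0 < i <= k, v \in nodes (st_tree s), st_kappa s i != fset0,
        children (st_tree s) v = st_kappa s i & (st_pi s).[? v] = Some (Xs i)];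
  forest_n_exists : forall i, i <= k -> st_kappa s i != fset0 ->
    exists v, (st_n s).[? i] = Some v;
  forest_pi : forall v A, (st_pi s).[? v] = Some A ->
    exists i, (st_n s).[? i] = Some v;
  forest_pi_dom : domf (st_pi s) = internal_nodes (st_tree s);
  forest_gamma_dom : domf (st_gamma s) = leaves (st_tree s);
  forest_placed : {in nodes (st_tree s), forall v,
    (exists i, v \in st_kappa s i) \/ (st_n s).[? m] = Some v};
  forest_gamma : forall v c, (st_gamma s).[? v] = Some c -> c \in phi;
  forest_gamma_uniq : {in phi, forall c, exists! v, (st_gamma s).[? v] = Some c}
}.

(* The leaf of a clause containing a variable x of X_i never gets stuck in a
   cluster beyond i: it lies below a node of a pending kappa_j with j <= i that
   still has x among its variables, until it lies below n_i. *)
Definition covered (k : nat) (s : cluster_state X) : Prop :=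
  forall c x i l, c \in phi -> x \in clause_vars c -> x \in Xs i ->
    (st_gamma s).[? l] = Some c ->
  (exists j v, [/\ k < j <= i, v \in st_kappa s j,
     descendant (st_tree s) v l & state_var s v x]) \/
  (exists2 n, i <= k /\ (st_n s).[? i] = Some n & descendant (st_tree s) n l).

Lemma forest_init : forest 0 (init_clusters phi ClauseRank rho).
Proof.
have [L Lphi [[pi0 n0] treeE kappaE gammaL gamma_uniq]] := initial_init_clusters.
set s := init_clusters _ _ _ in pi0 n0 treeE kappaE gammaL gamma_uniq *.
have no_children v : children (st_tree s) v = fset0.
  by rewrite /children treeE; case: _.[? v].
have nodesE v : (v \in nodes (st_tree s)) = isSome (st_gamma s).[? v].
  by rewrite /nodes (in_domf (st_tree s)) treeE; case: _.[? v].
have kappaP i v : v \in st_kappa s i ->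
    exists c, [/\ (st_gamma s).[? v] = Some c, c \in phi & rank c = i].
  rewrite kappaE; case gv: _.[? v] => [c|] // /eqP[ci].
  by exists c; rewrite -Lphi; have [_ ->] := gammaL _ _ gv.
split.
- by move=> v; rewrite nodesE; case gv: _.[? v] => [c|] // _; have [] := gammaL _ _ gv.
- by move=> v o; rewrite no_children.
- move=> i v /kappaP[c [gv cphi <-]]; rewrite nodesE gv; split=> //.
  exact: rank_bounds.
- by move=> i j v /kappaP[c [gv _ <-]] /kappaP[d [gv' _ <-]]; move: gv'; rewrite gv => -[->].
- by move=> i v; rewrite n0 fnd_fmap0.
(* Only i = 0 is to be checked, and kappa_0 is empty because ranks are at least 1. *)
- move=> i; rewrite leqn0 => /eqP-> /fset0Pn[v /kappaP[c [_ /rank_bounds]]].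
  by move=> /[swap] ->.
- by move=> v A; rewrite pi0 fnd_fmap0.
- by rewrite pi0; apply/fsetP => v; rewrite in_internal_nodes no_children eqxx andbF.
- apply/fsetP => v; rewrite in_leaves no_children eqxx andbT nodesE.
  exact: in_domf.
- move=> v; rewrite nodesE; case gv: _.[? v] => [c|] // _.
  by left; exists (rank c); rewrite kappaE gv.
- by move=> v c /gammaL[_]; rewrite Lphi.
- by move=> c; rewrite -Lphi => /gamma_uniq.
Qed.

Lemma covered_init : covered 0 (init_clusters phi ClauseRank rho).
Proof.
have [L Lphi [_ treeE kappaE _ _]] := initial_init_clusters.
move=> c x i l cphi xc /cluster_varsP[_ maxi] gl; left.
have /andP[rc0 rcm] := rank_bounds cphi.
(* The pending node is the leaf itself; its cluster index [rank c] is at most [i] by maximality of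
   [i]. *)
exists (rank c), l; split; first by rewrite rc0 maxi.
- by rewrite kappaE gl.
- by exists [::].
apply: NodeVarLeaf (gl) xc.
by rewrite in_leaves /nodes /children (in_domf (st_tree _)) treeE gl /=.
Qed.

(** * One iteration of the second loop *)

Hypothesis chosen_bounds : forall i s n,
  chosen_cluster_call phi ClauseRank rho ChosenCluster i s n ->
  i < ChosenCluster s n <= m.
Hypothesis chosen_disjoint : forall i s n,
  chosen_cluster_call phi ClauseRank rho ChosenCluster i s n ->
  forall k, i < k < ChosenCluster s n ->
  forall x, x \in Xs k -> ~ state_var s n x.

Lemma loopS (k : nat) :
  loop k.+1 = cluster_step phi ClauseRank rho ChosenCluster (loop k) k.+1.
Proof. by rewrite /loop /cluster_loop -(addn1 k) iotaD foldl_cat /= addnC. Qed.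

(** The effect of an iteration that creates a node, with [J] the chosen cluster. The facts about [J]
    are guarded by [k.+1 < m], since [ChosenCluster] is not called in the last iteration. *)
Lemma cluster_stepP (k : nat) (s := loop k) (n := st_next s)
    (X' := Xs k.+1) (s' := loop k.+1) :
    k < m -> st_kappa s k.+1 != fset0 ->
  exists J, [/\
    [/\ st_tree s' = (st_tree s).[n <- st_kappa s k.+1],
        st_gamma s' = st_gamma s, st_pi s' = (st_pi s).[n <- X'],
        st_n s' = (st_n s).[k.+1 <- n] & st_next s' = n.+1],
    forall i v, (v \in st_kappa s' i) =
      (v \in st_kappa s i) || [&& v == n, k.+1 < m & i == J],
    k.+1 < m -> k.+1 < J <= m
    & forall i x, k.+1 < m -> k.+1 < i < J -> x \in Xs i -> ~ state_var s' n x].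
Proof.
move=> km kappa_n0; rewrite {}/s' loopS /cluster_step -/s (negbTE kappa_n0) -/n.
set s1 := new_internal _ _ _; exists (ChosenCluster s1 n).
have call : k.+1 < m ->
    chosen_cluster_call phi ClauseRank rho ChosenCluster k.+1 s1 n.
  by move=> km'; split=> //; apply/eqP.
rewrite -/m; case: ltnP => [km'|_]; last first.
  by split=> // i v; rewrite andbF orbF.
split=> // [i v | _ | i x _ iJ xi].
- rewrite /=; case: (i =P _) => [->|_]; last by rewrite !andbF orbF.
  by rewrite in_fsetU in_fset1 andbT.
- exact/chosen_bounds/call.
(* The call sees [s1], but [add_to_cluster] changes only the clusters, so [state_var] is the same
   for both states. *)
- exact: chosen_disjoint (call km') _ iJ _ xi.
Qed.

(** The new node is fresh and enters a cluster beyond [k.+1], so the clusters that already have a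
    parent node no longer change. *)
Lemma forest_step (k : nat) : k < m -> forest k (loop k) -> forest k.+1 (loop k.+1).
Proof.
set s := loop k => km Fs.
have [kappa0|kappa_n0] := eqVneq (st_kappa s k.+1) fset0.
  have -> : loop k.+1 = s by rewrite loopS /cluster_step -/s kappa0 eqxx.
  case: Fs => H1 H2 H3 H4 nP n_ex H7 H8 H9 H10 H11 H12; split=> //.
    move=> i v /nP[/andP[i0 ik] vT ki cv piv]; split=> //.
    by rewrite i0 (leq_trans ik).
  by move=> i; rewrite leq_eqVlt => /predU1P[->|/n_ex//]; rewrite kappa0 eqxx.
have [J [[treeE gammaE piE nE nextE] kappaE J_bounds _]] := cluster_stepP km kappa_n0.
move: (loop k.+1) => s' in treeE gammaE piE nE nextE kappaE J_bounds *.
rewrite -/s in treeE gammaE piE nE nextE kappaE.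
set n := st_next s in treeE piE nE nextE kappaE.
case: Fs => lt_next childP kappaP kappa_inj nP n_ex piP pi_dom gamma_dom placed gammaP gamma_ex.
have n_fresh v : v \in nodes (st_tree s) -> v == n = false.
  by move=> /lt_next vn; rewrite ltn_eqF.
have nodesE v : (v \in nodes (st_tree s')) = (v == n) || (v \in nodes (st_tree s)).
  by rewrite /nodes treeE mem_setf.
have ext : extends (st_tree s) (st_tree s').
  by move=> v vT; rewrite treeE fnd_set n_fresh.
have children_n : children (st_tree s') n = st_kappa s k.+1.
  by rewrite /children treeE fnd_set eqxx.
have children_old v : v != n -> children (st_tree s') v = children (st_tree s) v.
  by move=> vn; rewrite /children treeE fnd_set (negbTE vn).
have kappa'E i : i <= k.+1 -> st_kappa s' i = st_kappa s i.
  move=> ik; apply/fsetP => v; rewrite kappaE.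
  case: (ltnP k.+1 m) => [/J_bounds/andP[kJ _]|_]; last by rewrite andbF orbF.
  by rewrite (ltn_eqF (leq_ltn_trans ik kJ)) !andbF orbF.
have n_notin i : n \in st_kappa s i = false.
  by apply/negP => /kappaP[/lt_next]; rewrite ltnn.
have kappa_or i v : v \in st_kappa s' i -> v \in st_kappa s i \/
    [/\ v = n, k.+1 < m & i = J].
  by rewrite kappaE => /orP[|/and3P[/eqP-> km' /eqP->]]; [left | right].
split.
- move=> v; rewrite nodesE nextE ltnS => /predU1P[->//|/lt_next/ltnW//].
- move=> v o; have [->|vn] := eqVneq v n.
    rewrite children_n => /kappaP[oT _]; rewrite nodesE oT orbT.
    by split=> //; apply: lt_next.
  rewrite children_old // => /childP[oT ov].
  by rewrite nodesE oT orbT.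
- move=> i v /kappa_or[/kappaP[vT ->] | [-> km' ->]]; rewrite nodesE ?vT ?orbT ?eqxx //.
  by have /andP[kJ ->] := J_bounds km'; rewrite (leq_ltn_trans _ kJ).
(* The mixed cases are void: the fresh [n] was in no cluster before. *)
- move=> i j v /kappa_or[vi|[-> _ ->]] /kappa_or[vj|[vn _ ->]] //.
  + exact: kappa_inj vi vj.
  + by rewrite vn n_notin in vi.
  + by rewrite n_notin in vj.
- move=> i v; rewrite nE fnd_set; case: eqP => [-> [<-]|_ /nP].
    by rewrite kappa'E // piE fnd_set eqxx nodesE eqxx ltnSn.
  move=> [/andP[i0 ik] vT ki cv piv]; rewrite kappa'E; last exact: leqW.
  rewrite nodesE vT orbT i0 (leqW ik) (extends_children ext) //.
  by rewrite piE fnd_set n_fresh.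
- move=> i ik; rewrite kappa'E // nE fnd_set.
  case: (i =P k.+1) => [_ _|/eqP i_k]; first by exists n.
  by apply: n_ex; rewrite -ltnS ltn_neqAle i_k.
- move=> v A; rewrite piE nE fnd_set; case: eqP => [-> _|_ /piP[i ni]].
    by exists k.+1; rewrite fnd_set eqxx.
  exists i; rewrite fnd_set; case: eqP => // ik.
  by have [/andP[_]] := nP _ _ ni; rewrite ik ltnn.
- apply/fsetP => v; rewrite piE mem_setf pi_dom inE /= !in_internal_nodes nodesE.
  have [->|vn] := eqVneq v n; first by rewrite children_n kappa_n0.
  by rewrite /= children_old.
- apply/fsetP => v; rewrite gammaE gamma_dom !in_leaves nodesE.
  have [->|vn] := eqVneq v n.
    rewrite children_n (negbTE kappa_n0) !andbF.
    by apply/negbTE; apply/negP => /andP[/lt_next]; rewrite ltnn.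
  by rewrite /= children_old.
(* The new node is in kappa_J, or else [k.+1 = m] and it is n_m. An old node cannot be n_m, as only
   n_1, ..., n_k could exist so far. *)
- move=> v; rewrite nodesE => /predU1P[->|vT].
    have [km'|mk] := ltnP k.+1 m.
      by left; exists J; rewrite kappaE !eqxx km' orbT.
    right; rewrite nE fnd_set; suff -> : m = k.+1 by rewrite eqxx.
    by apply/eqP; rewrite eqn_leq mk.
  have [[i vi]|nm] := placed v vT; first by left; exists i; rewrite kappaE vi.
  by have [/andP[_]] := nP _ _ nm; rewrite leqNgt km.
- by rewrite gammaE.
- by rewrite gammaE.
Qed.

(** Only pending nodes of kappa_{k+1} need a new witness, and it is their parent [n]: either [n] is
    n_i, or [x] survives in vars([n]) and [n] enters a cluster not beyond [i]. *)
Lemma covered_step (k : nat) : k < m -> forest k (loop k) ->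
  covered k (loop k) -> covered k.+1 (loop k.+1).
Proof.
set s := loop k => km Fs Cs.
have [kappa0|kappa_n0] := eqVneq (st_kappa s k.+1) fset0.
  have -> : loop k.+1 = s by rewrite loopS /cluster_step -/s kappa0 eqxx.
  move=> c x i l cphi xc xi gl.
  have [[j [v [/andP[kj ji] vj vl xv]]]|[n [ik ni] nl]] := Cs c x i l cphi xc xi gl.
    left; exists j, v; split=> //; rewrite ji andbT ltn_neqAle kj andbT.
    by apply: contraTneq vj => <-; rewrite kappa0.
  by right; exists n => //; split=> //; apply: leqW.
have [J [[treeE gammaE piE nE nextE] kappaE J_bounds J_disjoint]] :=
  cluster_stepP km kappa_n0.
move: (loop k.+1) => s' in treeE gammaE piE nE nextE kappaE J_bounds J_disjoint *.
rewrite -/s in treeE gammaE piE nE nextE kappaE J_disjoint.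
set n := st_next s in treeE piE nE nextE kappaE J_disjoint.
have n_fresh v : v \in nodes (st_tree s) -> v == n = false.
  by move=> /(forest_lt_next Fs) vn; rewrite ltn_eqF.
have ext : extends (st_tree s) (st_tree s').
  by move=> v vT; rewrite treeE fnd_set n_fresh.
have children_n : children (st_tree s') n = st_kappa s k.+1.
  by rewrite /children treeE fnd_set eqxx.
have state_var_ext v x : state_var s v x -> state_var s' v x.
  apply: extends_node_var => // [l c|w A pw]; rewrite ?gammaE // piE fnd_set.
  have [i /(forest_n Fs)[_ wT _ _ _]] := forest_pi Fs pw.
  by rewrite n_fresh.
move=> c x i l cphi xc xi; rewrite gammaE => gl.
have [[j [v [/andP[kj ji] vj vl xv]]]|[a [ik ai] al]] := Cs c x i l cphi xc xi gl.
  have [jk|j_k] := eqVneq j k.+1; last first.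
    left; exists j, v; split.
    - by rewrite ji andbT ltn_neqAle eq_sym j_k.
    - by rewrite kappaE vj.
    - exact: extends_descendant ext vl.
    - exact: state_var_ext.
  rewrite {}jk in kj ji vj.
  have nl : descendant (st_tree s') n l.
    apply: (descendant_child _ (extends_descendant ext vl)).
    by rewrite children_n.
  have [ik|i_k] := eqVneq i k.+1.
    by right; exists n => //; rewrite ik nE fnd_set eqxx.
  have lt_ki : k.+1 < i by rewrite ltn_neqAle eq_sym i_k.
  (* A clause [d] of rank [i] containing [x] gives [i <= m], so [ChosenCluster] is really called; it
     also shows below that [x] is not in X_{k+1}. *)
  have [[d [dphi rd xd]] _] := cluster_varsP _ _ xi.
  have i_m : i <= m by rewrite -rd; have /andP[] := rank_bounds dphi.
  have km' : k.+1 < m := leq_trans lt_ki i_m.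
  have xn : state_var s' n x.
    apply: (@NodeVarInternal _ _ _ _ _ (Xs k.+1) v).
    - rewrite in_internal_nodes children_n kappa_n0 andbT.
      by rewrite /nodes treeE mem_setf inE eqxx.
    - by rewrite piE fnd_set eqxx.
    - by rewrite children_n.
    - exact: state_var_ext.
    apply/cluster_varsP => -[_ maxk].
    have := maxk d dphi xd; rewrite rd => /(_ i_m).
    by rewrite leqNgt lt_ki.
  left; exists J, n; split=> //; last by rewrite kappaE !eqxx km' orbT.
  (* If [i < J], then X_i would be disjoint from vars([n]), yet both contain [x]. *)
  have /andP[-> _] := J_bounds km'; rewrite leqNgt /=.
  by apply/negP => iJ; case: (J_disjoint i x km' _ xi xn); rewrite lt_ki iJ.
right; exists a; last exact: extends_descendant ext al.
split; first exact: leqW.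
by rewrite nE fnd_set ltn_eqF.
Qed.

Lemma loop_invariant (k : nat) : k <= m -> forest k (loop k) /\ covered k (loop k).
Proof.
elim: k => [_ | k IHk km]; first by split; [apply: forest_init | apply: covered_init].
have [Fk Ck] := IHk (ltnW km).
by split; [apply: forest_step | apply: covered_step].
Qed.

(** * From the final state to a project-join tree *)

(** Climb from [v]: a node other than n_m lies in some kappa_i, hence is a child of n_i, whose name
    is larger. So one node suffices for n_m to exist, and n_m bounds all names. *)
Lemma forest_root (s : cluster_state X) (v : node) :
  forest m s -> v \in nodes (st_tree s) ->
  exists2 r, (st_n s).[? m] = Some r & v <= r.
Proof.
move=> Fs; have [d] := ubnP (st_next s - v); elim: d v => // d IHd v /ltnSE-le_d vT.
have [[i vi]|] := forest_placed Fs vT; last by exists v.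
have [_ /andP[i0 im]] := forest_kappa Fs vi.
have [|a ai] := forest_n_exists Fs im; first by apply/fset0Pn; exists v.
have [_ aT _ ca _] := forest_n Fs ai.
have [|_ va] := forest_children Fs (v := a) (o := v); first by rewrite ca.
have [||r nr ar] := IHd a => //.
  by apply: leq_trans le_d; apply: ltn_sub2l => //; apply: (forest_lt_next Fs).
by exists r => //; apply: leq_trans ar; apply: ltnW.
Qed.

Lemma forest_parent (k : nat) (s : cluster_state X) (v o : node) :
  forest k s -> o \in children (st_tree s) v ->
  exists2 i, (st_n s).[? i] = Some v & o \in st_kappa s i.
Proof.
move=> Fs ov.
have : v \in domf (st_pi s).
  rewrite (forest_pi_dom Fs) in_internal_nodes (children_nodes ov) /=.
  by apply/fset0Pn; exists o.
rewrite in_domf; case piv: _.[? v] => [A|] // _.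
have [i ni] := forest_pi Fs piv; exists i => //.
by have [_ _ _ <- _] := forest_n Fs ni.
Qed.

Lemma forest_rooted_tree (s : cluster_state X) (r : node) :
  forest m s -> (st_n s).[? m] = Some r -> rooted_tree (st_tree s) r.
Proof.
move=> Fs nr; have [_ rT _ _ _] := forest_n Fs nr.
apply: rooted_tree_of_parents => // [v vT | v o | o oT o_r | v w o ov ow].
- by have [r'] := forest_root Fs vT; rewrite nr => -[->].
- exact: (forest_children Fs).
- have [[i oi]|] := forest_placed Fs oT; last by rewrite nr => -[ro]; rewrite ro eqxx in o_r.
  have [_ /andP[_ im]] := forest_kappa Fs oi.
  have [|v ni] := forest_n_exists Fs im; first by apply/fset0Pn; exists o.
  by exists v; have [_ _ _ -> _] := forest_n Fs ni.
(* Both parents are n_i for the one i with [o] in kappa_i. *)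
have [i ni oi] := forest_parent Fs ov; have [j nj oj] := forest_parent Fs ow.
by move: nj; rewrite -(forest_kappa_inj Fs oi oj) ni => -[].
Qed.

Lemma forest_cluster_vars (k : nat) (s : cluster_state X) (v : node) (A : {set X}) :
  forest k s -> (st_pi s).[? v] = Some A ->
  exists2 i, (st_n s).[? i] = Some v & A = Xs i.
Proof.
move=> Fs piv; have [i ni] := forest_pi Fs piv; exists i => //.
by have [_ _ _ _] := forest_n Fs ni; rewrite piv => -[].
Qed.

Lemma cluster_vars_inj (i j : nat) (x : X) : x \in Xs i -> x \in Xs j -> i = j.
Proof.
have le a b : x \in Xs a -> x \in Xs b -> a <= b.
  move=> /cluster_varsP[[c [cphi <- xc]] _] /cluster_varsP[_]; apply=> //.
  by have /andP[] := rank_bounds cphi.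
by move=> xi xj; apply/eqP; rewrite eqn_leq !le.
Qed.

Lemma cluster_vars_cover (x : X) : x \in vars phi -> exists i, x \in Xs i.
Proof.
move=> /varsP[c cphi xc].
pose P d := (d \in phi) && (x \in clause_vars d).
have [|d /andP[dphi xd] maxd] := @arg_maxnP _ c P rank; first by rewrite /P cphi.
exists (rank d); apply/cluster_varsP; split; first by exists d.
by move=> e ephi xe _; apply: maxd; rewrite /P ephi.
Qed.

(** After [m] iterations no cluster is pending, since [m < j <= i <= m] is absurd. Thus [covered]
    places every leaf whose clause contains a variable of X_i below an existing n_i. *)
Lemma forest_covered_project_join_tree (s : cluster_state X) (r : node) :
    vars phi = [set: X] -> forest m s -> covered m s ->
    (st_n s).[? m] = Some r ->
  project_join_tree phi (LabeledTree (st_tree s) r (st_gamma s) (st_pi s)).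
Proof.
move=> phiX Fs Cs nr; split.
- exact: forest_rooted_tree.
- by split; [apply: (forest_gamma_dom Fs) | apply: (forest_gamma Fs)
    | apply: (forest_gamma_uniq Fs)].
- split; first exact: (forest_pi_dom Fs).
    move=> v w A B vA wB vw; apply/setP => x; rewrite inE in_set0; apply/negP => /andP[].
    have [i ni ->] := forest_cluster_vars Fs vA.
    have [j nj ->] := forest_cluster_vars Fs wB.
    move=> xi xj; apply: vw; move: nj; rewrite -(cluster_vars_inj xi xj) ni.
    by case.
  (* It must be shown that n_i was created for the [i] with [x] in X_i; the leaf of a clause
     containing [x] provides it through [covered]. *)
  move=> x; have [|i xi] := @cluster_vars_cover x; first by rewrite phiX.
  have [[c [cphi rc xc]] _] := cluster_varsP _ _ xi.
  have im : i <= m by rewrite -rc; have /andP[] := rank_bounds cphi.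
  have [l [gl _]] := forest_gamma_uniq Fs cphi.
  have [[j [v [/andP[mj ji] _ _ _]]]|[n [_ ni] _]] := Cs c x i l cphi xc xi gl.
    by have := leq_trans (leq_trans mj ji) im; rewrite ltnn.
  by exists n, (Xs i); have [_ _ _ _ ->] := forest_n Fs ni.
move=> n A x c l nA xA cphi xc gl.
have [i ni AX] := forest_cluster_vars Fs nA; rewrite {}AX in xA.
have [[j [v [/andP[mj ji] _ _ _]]]|[n' [_ ni'] n'l]] := Cs c x i l cphi xc xA gl.
  have [/andP[_ im] _ _ _ _] := forest_n Fs ni.
  by have := leq_trans (leq_trans mj ji) im; rewrite ltnn.
by move: ni'; rewrite ni => -[->].
Qed.

Lemma cluster_loop_project_join_tree :
    0 < m -> vars phi = [set: X] ->
  exists r, (st_n (loop m)).[? m] = Some r /\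
    project_join_tree phi (LabeledTree (st_tree (loop m)) r
      (st_gamma (loop m)) (st_pi (loop m))).
Proof.
(* Some variable exists and occurs in a clause, so there is a leaf, and climbing from it reaches
   n_m. *)
move=> /card_gt0P[x _] phiX; have [Fs Cs] := loop_invariant (leqnn m).
have /varsP[c cphi _] : x \in vars phi by rewrite phiX.
have [l [gl _]] := forest_gamma_uniq Fs cphi.
have : l \in leaves (st_tree (loop m)) by rewrite -(forest_gamma_dom Fs) in_domf gl.
rewrite in_leaves => /andP[lT _]; have [r nr _] := forest_root Fs lT.
by exists r; split=> //; apply: forest_covered_project_join_tree.
Qed.

End Cluster.

Theorem theorem3 (X : finType) (m : nat) (hX : #|X| = m) (hm : 1 <= m)
    (phi : cnf X) (hphi : vars phi = [set: X])
    (ClusterVarOrder : cnf X -> X -> nat)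
    (ClauseRank : clause X -> (X -> nat) -> nat)
    (ChosenCluster : cluster_state X -> node -> nat)
    (hrho : injective (ClusterVarOrder phi))
    (hrank : forall c : clause X, c \in phi ->
       1 <= ClauseRank c (ClusterVarOrder phi) <= m)
    (hchosen : forall (i : nat) (s : cluster_state X) (n : node),
       chosen_cluster_call phi ClauseRank (ClusterVarOrder phi) ChosenCluster
         i s n ->
       i < ChosenCluster s n <= m)
    (hdisjoint : forall (i : nat) (s : cluster_state X) (n : node),
       chosen_cluster_call phi ClauseRank (ClusterVarOrder phi) ChosenCluster
         i s n ->
       forall k : nat, i < k < ChosenCluster s n ->
       forall x : X,
         x \in cluster_vars phi ClauseRank (ClusterVarOrder phi) k ->
         ~ state_var s n x) :
  exists t : labeled_tree X,
    cluster phi ClusterVarOrder ClauseRank ChosenCluster = Some t /\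
    project_join_tree phi t.
Proof.
subst m.
have [r [nr pjt]] :=
  cluster_loop_project_join_tree hrank hchosen hdisjoint hm hphi.
by eexists; split; last exact: pjt; rewrite /cluster nr.
Qed.
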